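(* Let $M$ be a universal semi-POVM and let $x\in\mathbb{C}^N$ be computable with $\|x\|=1$. Then the map $\Sigma^*\ni s\mapsto x^\dagger M(s)x$ is a universal probability.
   Context: $N$ is a fixed positive integer; $\Sigma^*$ is the set of finite binary strings. A vector $x\in\mathbb{C}^N$ is computable if each component is $a+ib$ with $a,b$ computable real numbers. $\mathrm{Her}(N)$ is the set of $N\times N$ Hermitian matrices and $\mathrm{Her}_Q(N)$ those with entries in $\{a+ib:a,b\in\mathbb{Q}\}$; $A\leqslant B$ means $B-A$ is positive semi-definite. A lower-computable semi-measure is a function $r:\Sigma^*\to[0,\infty)$ with $\sum_s r(s)\le 1$ such that there is a total recursive $f:\mathbb{N}\times\Sigma^*\to\mathbb{Q}$ with $\lim_{n}f(n,s)=r(s)$ and $f(n,s)\le f(n+1,s)$ for all $n,s$. A universal probability is a lower-computable semi-measure $m$ such that for every lower-computable semi-measure $r$ there is $c>0$ with $c\,r(s)\le m(s)$ for all $s$. A semi-POVM on $\Sigma^*$ is a map $R:\Sigma^*\to\mathrm{Her}(N)$ with $0\leqslant R(s)$ for all $s$ and $\sum_s R(s)\leqslant I$. A lower-computable semi-POVM is a semi-POVM $R$ for which there is a total recursive $f:\mathbb{N}\times\Sigma^*\to\mathrm{Her}_Q(N)$ with $\lim_{n}f(n,s)=R(s)$ and $f(n,s)\leqslant R(s)$ for all $n,s$. A universal semi-POVM is a lower-computable semi-POVM $M$ such that for every lower-computable semi-POVM $R$ there is $c>0$ with $c\,R(s)\leqslant M(s)$ for all $s\in\Sigma^*$. *)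

(* Defs.v *)
From HB Require Import structures.
From mathcomp Require Import all_boot all_order all_algebra.
From mathcomp Require Import sesquilinear.
From mathcomp Require Import complex.
From mathcomp Require Import boolp classical_sets reals topology normedtype sequences.
From mathcomp Require Import Rstruct Rstruct_topology.

Set Implicit Arguments.
Unset Strict Implicit.
Unset Printing Implicit Defensive.

Import Order.TTheory GRing.Theory Num.Theory.
Local Open Scope classical_set_scope.
Local Open Scope ring_scope.

Definition Real : realType := Rdefinitions.R.
Definition Cplx := Real[i].
Definition str := seq bool.

(* A model of computation: partial recursive (mu-recursive) functions        *)
(* nat -> nat, in unary form using the Cantor pairing function.              *)

(** Cantor pairing nat * nat -> nat (a bijection). *)
Definition cpair (x y : nat) : nat := (((x + y) * (x + y).+1)./2 + y)%N.

Inductive prog : Type :=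
  | PZero
  | PSucc
  | PId
  | PFst
  | PSnd
  | PComp (p q : prog)
  | PPair (p q : prog)
  | PRec (p q : prog)
  | PMu (p : prog).

Inductive eval : prog -> nat -> nat -> Prop :=
  | eval_zero x : eval PZero x 0
  | eval_succ x : eval PSucc x x.+1
  | eval_id x : eval PId x x
  | eval_fst x y : eval PFst (cpair x y) x
  | eval_snd x y : eval PSnd (cpair x y) y
  | eval_comp p q x y z : eval q x y -> eval p y z -> eval (PComp p q) x z
  | eval_pair p q x y z : eval p x y -> eval q x z -> eval (PPair p q) x (cpair y z)
  | eval_rec0 p q x y : eval p x y -> eval (PRec p q) (cpair x 0) y
  | eval_recS p q x n y z :
      eval (PRec p q) (cpair x n) y -> eval q (cpair x (cpair n y)) z ->
      eval (PRec p q) (cpair x n.+1) z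
  | eval_mu p x n :
      eval p (cpair x n) 0 ->
      (forall m, (m < n)%N -> exists k, eval p (cpair x m) k.+1) ->
      eval (PMu p) x n.

Definition total_recursive (f : nat -> nat) : Prop :=
  exists p : prog, forall x, eval p x (f x).

Fixpoint enc_str (s : str) : nat :=
  match s with
  | [::] => 0%N
  | b :: s' => ((enc_str s').*2 + b).+1
  end.

Definition enc_int (z : int) : nat :=
  match z with
  | Posz n => n.*2
  | Negz n => (n.*2).+1
  end.

Definition enc_rat (q : rat) : nat := cpair (enc_int (numq q)) `|denq q|%N.

Definition enc_gauss (z : rat[i]) : nat := cpair (enc_rat (complex.Re z)) (enc_rat (complex.Im z)).

Definition enc_list (l : seq nat) : nat := foldr (fun a acc => (cpair a acc).+1) 0%N l.

Definition enc_mx (N : nat) (A : 'M[rat[i]]_N) : nat :=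
  enc_list [seq enc_gauss (A i j) | i <- enum 'I_N, j <- enum 'I_N].

Definition computable_real (a : Real) : Prop :=
  exists g : nat -> rat,
    total_recursive (fun n => enc_rat (g n)) /\
    forall n, `|a - ratr (g n)| <= ((2 : Real) ^+ n)^-1.

Definition computable_complex (z : Cplx) : Prop :=
  computable_real (complex.Re z) /\ computable_real (complex.Im z).

Definition computable_vec (N : nat) (x : 'cV[Cplx]_N) : Prop :=
  forall i, computable_complex (x i 0).

(** A total function F : N x Sigma^* -> nat (output already encoded) is
    total recursive: computed on the code <n, enc_str s> of its input. *)
Definition total_recursive2 (F : nat -> str -> nat) : Prop :=
  exists p : prog, forall n s, eval p (cpair n (enc_str s)) (F n s).

(** r : Sigma^* -> [0, oo) with sum_s r(s) <= 1 (every finite partial sum <= 1). *)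
Definition semi_measure (r : str -> Real) : Prop :=
  (forall s, 0 <= r s) /\
  (forall l : seq str, uniq l -> \sum_(s <- l) r s <= 1).

Definition lower_computable_semi_measure (r : str -> Real) : Prop :=
  semi_measure r /\
  exists f : nat -> str -> rat,
    total_recursive2 (fun n s => enc_rat (f n s)) /\
    (forall s, (fun n => (ratr (f n s) : Real)) @ \oo --> r s) /\
    (forall n s, f n s <= f n.+1 s).

Definition universal_probability (m : str -> Real) : Prop :=
  lower_computable_semi_measure m /\
  forall r : str -> Real, lower_computable_semi_measure r ->
    exists c : Real, 0 < c /\ forall s, c * r s <= m s.

Local Open Scope sesquilinear_scope.

Definition psd (N : nat) (A : 'M[Cplx]_N) : Prop :=
  A \is hermsymmx /\ forall v : 'cV[Cplx]_N, 0 <= (v ^t* *m A *m v) 0 0.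

Definition loewner_le (N : nat) (A B : 'M[Cplx]_N) : Prop := psd (B - A).

Definition gauss_to_C (z : rat[i]) : Cplx := Complex (ratr (complex.Re z)) (ratr (complex.Im z)).

Definition gmx (N : nat) (A : 'M[rat[i]]_N) : 'M[Cplx]_N := map_mx gauss_to_C A.

(** Semi-POVM on Sigma^*: R(s) Hermitian, 0 <= R(s), and sum_s R(s) <= I
    (every finite partial sum is <= I). *)
Definition semi_POVM (N : nat) (R : str -> 'M[Cplx]_N) : Prop :=
  (forall s, R s \is hermsymmx) /\
  (forall s, loewner_le 0 (R s)) /\
  (forall l : seq str, uniq l -> loewner_le (\sum_(s <- l) R s) 1%:M).

Definition mx_cvg (N : nat) (u : nat -> 'M[Cplx]_N) (A : 'M[Cplx]_N) : Prop :=
  forall i j, (fun n => complex.Re (u n i j)) @ \oo --> complex.Re (A i j) /\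
              (fun n => complex.Im (u n i j)) @ \oo --> complex.Im (A i j).

Definition lower_computable_semi_POVM (N : nat) (R : str -> 'M[Cplx]_N) : Prop :=
  semi_POVM R /\
  exists f : nat -> str -> 'M[rat[i]]_N,
    total_recursive2 (fun n s => enc_mx (f n s)) /\
    (forall n s, gmx (f n s) \is hermsymmx) /\
    (forall s, mx_cvg (fun n => gmx (f n s)) (R s)) /\
    (forall n s, loewner_le (gmx (f n s)) (R s)).

Definition universal_semi_POVM (N : nat) (M : str -> 'M[Cplx]_N) : Prop :=
  lower_computable_semi_POVM M /\
  forall R : str -> 'M[Cplx]_N, lower_computable_semi_POVM R ->
    exists c : Real, 0 < c /\ forall s, loewner_le (Complex c 0 *: R s) (M s).

(** The map s |-> x^dagger M(s) x (real-valued since M(s) is Hermitian;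
    we take its real part to view it as a function into the reals). *)
Definition quad_form (N : nat) (M : str -> 'M[Cplx]_N) (x : 'cV[Cplx]_N) : str -> Real :=
  fun s => complex.Re ((x ^t* *m M s *m x) 0 0).

(* Main.v *)
Require Import Defs.
From HB Require Import structures.
From mathcomp Require Import all_boot all_order all_algebra.
From mathcomp Require Import sesquilinear complex.
From mathcomp Require Import boolp classical_sets reals topology normedtype sequences.
From mathcomp Require Import Rstruct Rstruct_topology.
From mathcomp Require Import zify ring lra.
Import Order.TTheory GRing.Theory Num.Theory.
Local Open Scope ring_scope.

Set Implicit Arguments.
Unset Strict Implicit.

(** Universality: if [r] is a lower-computable semi-measure then [r(s) I] is a
    lower-computable semi-POVM, so [c r(s) I <= M(s)] for some [c > 0], and
    evaluating at the unit vector [x] gives [c r(s) <= x^* M(s) x].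

    Lower computability: let [f(n,s) <= M(s)] be the rational approximations of
    [M(s)] and [x_n] rational approximations of [x] up to [2^-n] in each
    coordinate. Subtracting from [x_n^* f(n,s) x_n] an explicit bound, of order
    [2^-n |f(n,s)|], on the error of replacing [x] by [x_n] gives a computable
    rational below [x^* f(n,s) x <= x^* M(s) x] and with limit [x^* M(s) x]; its
    running maximum in [n] is the required monotone approximation. *)

(** * Recursive functions *)

(* Inputs are indexed by an arbitrary type [T] through a code [e]; no property
   of [e] is needed, so bijectivity of Cantor pairing is never used. *)
Definition recursive_on {T : Type} (e f : T -> nat) : Prop :=
  exists p : prog, forall t, Defs.eval p (e t) (f t).

Lemma recursive_on_ext {T : Type} (e f g : T -> nat) :
  recursive_on e f -> f =1 g -> recursive_on e g.
Proof. by move=> [p hp] fg; exists p => t; rewrite -fg. Qed.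

Lemma recursive_on_code {T : Type} (e : T -> nat) : recursive_on e e.
Proof. by exists PId => t; apply: eval_id. Qed.

(** Substitution rule, realised by [PComp]: a program working on the codes [e'] may be run at [h t]
    once the code of [h t] can be computed from that of [t]. *)
Lemma recursive_on_reindex {T U : Type} (e : T -> nat) (e' f : U -> nat)
    (h : T -> U) :
  recursive_on e' f -> recursive_on e (e' \o h) -> recursive_on e (f \o h).
Proof.
by move=> [p hp] [q hq]; exists (PComp p q) => t; apply: eval_comp (hq t) (hp _).
Qed.

Lemma recursive_on_comp {T : Type} (e g : T -> nat) (f : nat -> nat) :
  total_recursive f -> recursive_on e g -> recursive_on e (fun t => f (g t)).
Proof. exact: (@recursive_on_reindex T nat e id f g). Qed.

Lemma recursive_on_succ {T : Type} (e f : T -> nat) :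
  recursive_on e f -> recursive_on e (fun t => (f t).+1).
Proof.
by apply: (recursive_on_comp (f := S)); exists PSucc => t; apply: eval_succ.
Qed.

Lemma recursive_on_cst {T : Type} (e : T -> nat) (n : nat) :
  recursive_on e (fun=> n).
Proof.
elim: n => [|n IH]; last exact: recursive_on_succ IH.
by exists PZero => t; apply: eval_zero.
Qed.

Lemma recursive_on_pair {T : Type} (e f g : T -> nat) :
  recursive_on e f -> recursive_on e g ->
  recursive_on e (fun t => cpair (f t) (g t)).
Proof.
by move=> [p hp] [q hq]; exists (PPair p q) => t; apply: eval_pair.
Qed.

Lemma recursive_on_fst {T : Type} (e f g : T -> nat) :
  recursive_on e (fun t => cpair (f t) (g t)) -> recursive_on e f.
Proof.
by move=> [p hp]; exists (PComp PFst p) => t; apply: eval_comp (hp t) (eval_fst _ _).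
Qed.

Lemma recursive_on_snd {T : Type} (e f g : T -> nat) :
  recursive_on e (fun t => cpair (f t) (g t)) -> recursive_on e g.
Proof.
by move=> [p hp]; exists (PComp PSnd p) => t; apply: eval_comp (hp t) (eval_snd _ _).
Qed.

Definition code2 (u : nat * nat) : nat := cpair u.1 u.2.

Lemma recursive_on_binop {T : Type} (op : nat -> nat -> nat) (e f g : T -> nat) :
  recursive_on code2 (fun u => op u.1 u.2) ->
  recursive_on e f -> recursive_on e g ->
  recursive_on e (fun t => op (f t) (g t)).
Proof.
move=> hop hf hg.
apply: (@recursive_on_reindex T _ e code2 _ (fun t => (f t, g t)) hop).
exact: recursive_on_pair.
Qed.

(** Mirrors the input that [PRec] hands to its step program: context, counter, accumulator. The
    accumulator has any type [V] with a code [c], so that recursions may also run over rationals. *)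
Definition code_rec {T V : Type} (e : T -> nat) (c : V -> nat)
    (u : T * nat * V) : nat :=
  cpair (e u.1.1) (cpair u.1.2 (c u.2)).

Definition code_fst {T : Type} (e : T -> nat) (u : T * nat) : nat :=
  cpair (e u.1) u.2.

Lemma recursive_on_prim {T V : Type} (e : T -> nat) (c : V -> nat) (f : T -> V)
    (g : T -> nat -> V -> V) :
  recursive_on e (c \o f) ->
  recursive_on (code_rec e c) (fun u => c (g u.1.1 u.1.2 u.2)) ->
  recursive_on (code_fst e) (fun u => c (nat_rect (fun=> V) (f u.1) (g u.1) u.2)).
Proof.
move=> [p hp] [q hq]; exists (PRec p q) => -[t n]; rewrite /code_fst /=.
elim: n => [|n IH] /=; first exact: eval_rec0.
by apply: eval_recS IH _; apply: (hq (t, n, _)).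
Qed.

(** Unbounded search in which the least zero [m] is named beforehand, so that termination is part of
    the hypotheses. *)
Lemma recursive_on_mu {T : Type} (e m : T -> nat) (h : T -> nat -> nat) :
  recursive_on (code_fst e) (fun u => h u.1 u.2) ->
  (forall t, h t (m t) = 0%N) -> (forall t k, (k < m t)%N -> (0 < h t k)%N) ->
  recursive_on e m.
Proof.
move=> [p hp] hm0 hmin; exists (PMu p) => t; apply: eval_mu.
  by rewrite -(hm0 t); apply: (hp (t, m t)).
move=> k /hmin hk; exists (h t k).-1; rewrite prednK //; exact: (hp (t, k)).
Qed.

Lemma recursive_rec_acc {T V : Type} (e : T -> nat) (c : V -> nat) :
  recursive_on (code_rec e c) (fun u => c u.2).
Proof. by do 2 apply: recursive_on_snd; exact: recursive_on_code. Qed.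

Lemma recursive_rec_idx {T V : Type} (e : T -> nat) (c : V -> nat) :
  recursive_on (code_rec e c) (fun u => u.1.2).
Proof.
by apply: recursive_on_fst; apply: recursive_on_snd; exact: recursive_on_code.
Qed.

Lemma recursive_rec_ctx {T V : Type} (e : T -> nat) (c : V -> nat) :
  recursive_on (code_rec e c) (fun u => e u.1.1).
Proof. by apply: recursive_on_fst; exact: recursive_on_code. Qed.

Lemma recursive_on_add {T : Type} (e f g : T -> nat) :
  recursive_on e f -> recursive_on e g ->
  recursive_on e (fun t => f t + g t)%N.
Proof.
apply: recursive_on_binop.
apply: recursive_on_ext (recursive_on_prim (e := id) (c := id) (f := id)
  (g := fun _ _ y => y.+1) _ _) _.
- exact: recursive_on_code.
- exact/recursive_on_succ/recursive_rec_acc.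
- by move=> [a n] /=; elim: n => [|n IH] /=; rewrite ?addn0 // IH addnS.
Qed.

Lemma recursive_on_mul {T : Type} (e f g : T -> nat) :
  recursive_on e f -> recursive_on e g ->
  recursive_on e (fun t => f t * g t)%N.
Proof.
apply: recursive_on_binop.
apply: recursive_on_ext (recursive_on_prim (e := id) (c := id) (f := fun=> 0%N)
  (g := fun a _ y => a + y)%N _ _) _.
- exact: recursive_on_cst.
- exact: recursive_on_add (recursive_rec_ctx _ _) (recursive_rec_acc _ _).
- by move=> [a n] /=; elim: n => [|n IH] /=; rewrite ?muln0 // IH mulnS.
Qed.

Lemma recursive_on_pred {T : Type} (e f : T -> nat) :
  recursive_on e f -> recursive_on e (fun t => (f t).-1).
Proof.
(* The first argument is a dummy. The recursion ignores its accumulator and returns the counter,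
   which at stage [n.+1] equals [n]. *)
move=> hf; apply: (recursive_on_binop (op := fun _ => predn) _ hf hf).
apply: recursive_on_ext (recursive_on_prim (e := id) (c := id) (f := fun=> 0%N)
  (g := fun _ n _ => n) _ _) _.
- exact: recursive_on_cst.
- exact: recursive_rec_idx.
- by move=> [a [|n]].
Qed.

Lemma recursive_on_sub {T : Type} (e f g : T -> nat) :
  recursive_on e f -> recursive_on e g ->
  recursive_on e (fun t => f t - g t)%N.
Proof.
apply: recursive_on_binop.
apply: recursive_on_ext (recursive_on_prim (e := id) (c := id) (f := id)
  (g := fun _ _ y => y.-1) _ _) _.
- exact: recursive_on_code.
- exact/recursive_on_pred/recursive_rec_acc.
- by move=> [a n] /=; elim: n => [|n IH] /=; rewrite ?subn0 // IH subnS.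
Qed.

Lemma recursive_on_exp {T : Type} (e f : T -> nat) (b : nat) :
  recursive_on e f -> recursive_on e (fun t => b ^ f t)%N.
Proof.
move=> hf; apply: (recursive_on_binop (op := fun _ n => (b ^ n)%N) _ hf hf).
apply: recursive_on_ext (recursive_on_prim (e := id) (c := id) (f := fun=> 1%N)
  (g := fun _ _ y => b * y)%N _ _) _.
- exact: recursive_on_cst.
- exact: recursive_on_mul (recursive_on_cst _ b) (recursive_rec_acc _ _).
- by move=> [a n] /=; elim: n => [|n IH] //=; rewrite IH expnS.
Qed.

Lemma recursive_on_max {T : Type} (e f g : T -> nat) :
  recursive_on e f -> recursive_on e g ->
  recursive_on e (fun t => maxn (f t) (g t)).
Proof.
move=> hf hg.
apply: recursive_on_ext (recursive_on_add hf (recursive_on_sub hg hf)) _ => t.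
by rewrite /= maxnE.
Qed.

Lemma recursive_on_weaken {T : Type} (e f : T -> nat) :
  recursive_on e f -> recursive_on (code_fst e) (fun u => f u.1).
Proof.
move=> hf; apply: (@recursive_on_reindex _ _ _ e f fst hf).
by apply: recursive_on_fst; exact: recursive_on_code.
Qed.

Lemma recursive_fst_idx {T : Type} (e : T -> nat) :
  recursive_on (code_fst e) (fun u => u.2).
Proof. by apply: recursive_on_snd; exact: recursive_on_code. Qed.

(* The quotient is the least [k] with [a < (k + 1) d]. *)
Lemma recursive_on_div {T : Type} (e f g : T -> nat) :
  (forall t, 0 < g t)%N -> recursive_on e f -> recursive_on e g ->
  recursive_on e (fun t => f t %/ g t)%N.
Proof.
move=> g0 hf hg.
apply: (recursive_on_mu (h := fun t k => (f t).+1 - k.+1 * g t)%N).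
- apply: recursive_on_sub.
    exact/recursive_on_succ/recursive_on_weaken.
  apply: recursive_on_mul; last exact: recursive_on_weaken.
  exact/recursive_on_succ/recursive_fst_idx.
- move=> t; apply/eqP; rewrite subn_eq0; exact: ltn_ceil.
- by move=> t k; rewrite subn_gt0 ltnS leq_divRL.
Qed.

Lemma recursive_on_mod {T : Type} (e f g : T -> nat) :
  (forall t, 0 < g t)%N -> recursive_on e f -> recursive_on e g ->
  recursive_on e (fun t => f t %% g t)%N.
Proof.
move=> g0 hf hg.
apply: recursive_on_ext (recursive_on_sub hf (recursive_on_mul
  (recursive_on_div g0 hf hg) hg)) _ => t /=.
by rewrite {1}(divn_eq (f t) (g t)) addKn.
Qed.

(** * Recursive rational-valued functions *)

Definition recursive_rat {T : Type} (e : T -> nat) (q : T -> rat) : Prop :=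
  recursive_on e (fun t => enc_rat (q t)).

(** Unreduced fractions with numerator a difference of naturals: arithmetic on them needs neither
    sign distinctions nor normalisation. *)
Definition nat_fraction {T : Type} (e : T -> nat) (q : T -> rat)
    (a b d : T -> nat) : Prop :=
  [/\ recursive_on e a, recursive_on e b, recursive_on e d, (forall t, 0 < d t)%N
    & forall t, q t = ((a t)%:R - (b t)%:R) / (d t)%:R].

Lemma recursive_rat_fraction {T : Type} (e : T -> nat) (q : T -> rat) :
  recursive_rat e q -> exists a b d, nat_fraction e q a b d.
Proof.
move=> hq; have hn := recursive_on_fst hq; have hd := recursive_on_snd hq.
pose c t := enc_int (numq (q t)).
have h2 (g : T -> nat) : recursive_on e g -> recursive_on e (fun t => g t %/ 2)%N.
  by move=> hg; apply: recursive_on_div => //; exact: recursive_on_cst.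
have hm (g : T -> nat) : recursive_on e g -> recursive_on e (fun t => g t %% 2)%N.
  by move=> hg; apply: recursive_on_mod => //; exact: recursive_on_cst.
(* [enc_int] stores the sign as the parity of the code. The factors [1 - c t %% 2] and [c t %% 2]
   switch on the positive and the negative part; an odd code [2n + 1] stands for [-(n + 1)], hence
   the successor. *)
exists (fun t => c t %/ 2 * (1 - c t %% 2))%N,
  (fun t => (c t %/ 2).+1 * (c t %% 2))%N, (fun t => `|denq (q t)|%N); split => //.
- apply: recursive_on_mul (h2 _ hn) _.
  exact: recursive_on_sub (recursive_on_cst _ 1) (hm _ hn).
- exact: recursive_on_mul (recursive_on_succ (h2 _ hn)) (hm _ hn).
- by move=> t; rewrite absz_gt0 denq_neq0.
- move=> t; rewrite -{1}(divq_num_den (q t)); congr (_ / _).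
    rewrite /c; case: (numq (q t)) => n /=.
      by rewrite -muln2 mulnK // modnMl muln1 muln0 subr0.
    have -> : (n.*2.+1 %/ 2 = n)%N by lia.
    have -> : (n.*2.+1 %% 2 = 1)%N by lia.
    by rewrite subnn muln0 muln1 sub0r NegzE rmorphN.
  by rewrite natr_absz gtr0_norm ?denq_gt0.
Qed.

(* The reduced denominator of [n / d] is the least [k > 0] with [d %| k * n],
   so normalisation needs no gcd. *)
Lemma fraction_recursive_rat {T : Type} (e : T -> nat) (q : T -> rat)
    (a b d : T -> nat) :
  nat_fraction e q a b d -> recursive_rat e q.
Proof.
move=> [ha hb hd d0 qE].
pose n t := ((a t - b t) + (b t - a t))%N.
have hn : recursive_on e n.
  exact: recursive_on_add (recursive_on_sub ha hb) (recursive_on_sub hb ha).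
have cross t : ((a t)%:Z - (b t)%:Z) * denq (q t) = numq (q t) * (d t)%:Z.
  apply: (@intr_inj rat); rewrite !rmorphM /= rmorphB /= numqE {2}qE -!pmulrn.
  have dn0 : ((d t)%:R : rat) != 0 by rewrite pnatr_eq0 -lt0n.
  by field.
have absn t : `|(a t)%:Z - (b t)%:Z|%N = n t by rewrite /n; lia.
have crossn t : (n t * `|denq (q t)| = `|numq (q t)| * d t)%N.
  by rewrite -absn -abszM cross abszM.
have den0 t : (0 < `|denq (q t)|)%N by rewrite absz_gt0 denq_neq0.
have hden : recursive_on e (fun t => `|denq (q t)|%N).
  (* The search starts at 0 while denominators start at 1: the counter [k] stands for the candidate
     [k.+1]. *)
  apply: (recursive_on_ext (f := fun t => `|denq (q t)|.-1.+1)); last first.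
    by move=> t; rewrite prednK.
  apply: recursive_on_succ.
  apply: (recursive_on_mu (h := fun t k => k.+1 * n t %% d t)%N).
  - apply: recursive_on_mod; first by move=> u; exact: d0.
      apply: recursive_on_mul; last exact: recursive_on_weaken.
      exact/recursive_on_succ/recursive_fst_idx.
    exact: recursive_on_weaken.
  - by move=> t; rewrite prednK // mulnC crossn modnMl.
  - move=> t k hk; rewrite lt0n; apply/negP => /dvdnP[j hj].
    have : (`|denq (q t)| %| k.+1)%N.
      (* Numerator and denominator are coprime, so by Gauss the denominator divides every successful
         candidate and none is smaller. *)
      rewrite -(@Gauss_dvdl _ _ `|numq (q t)|%N); last first.
        by rewrite coprime_sym coprime_num_den.
      apply/dvdnP; exists j; apply/eqP; rewrite -(eqn_pmul2r (d0 t)).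
      by rewrite -mulnA -crossn mulnA hj -!mulnA [(d t * _)%N]mulnC.
    move=> /dvdn_leq => /(_ isT); lia.
have hnum : recursive_on e (fun t => `|numq (q t)|%N).
  apply: recursive_on_ext (recursive_on_div d0 (recursive_on_mul hn hden) hd) _.
  by move=> t /=; rewrite crossn mulnK.
apply: (recursive_on_pair _ hden).
(* The code of the numerator is [2 |num|], minus 1 if it is negative; in truncated subtraction
   [1 - (1 - (b - a))] is 1 exactly when [a < b]. *)
apply: recursive_on_ext (recursive_on_sub (recursive_on_mul hnum
  (recursive_on_cst _ 2)) (recursive_on_sub (recursive_on_cst _ 1)
  (recursive_on_sub (recursive_on_cst _ 1) (recursive_on_sub hb ha)))) _ => t /=.
have := cross t; have := d0 t; have := denq_gt0 (q t).
case: (numq (q t)) => m /= den_gt0 dt0 E.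
  have : 0 <= (a t)%:Z - (b t)%:Z by rewrite -(pmulr_lge0 _ den_gt0) E.
  lia.
have : (a t)%:Z - (b t)%:Z < 0.
  by rewrite -(pmulr_llt0 _ den_gt0) E pmulr_llt0.
lia.
Qed.

Section RecursiveRat.
Variables (T : Type) (e : T -> nat).
Implicit Types p q : T -> rat.

Lemma recursive_rat_ext p q : recursive_rat e p -> p =1 q -> recursive_rat e q.
Proof. by move=> hp pq; apply: recursive_on_ext hp _ => t; rewrite pq. Qed.

Lemma recursive_rat_cst (c : rat) : recursive_rat e (fun=> c).
Proof. exact: recursive_on_cst. Qed.

Lemma recursive_rat_opp q : recursive_rat e q -> recursive_rat e (fun t => - q t).
Proof.
move=> /recursive_rat_fraction [a [b [d [ha hb hd d0 qE]]]].
apply: (@fraction_recursive_rat _ _ _ b a d); split => // t.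
by rewrite qE -mulNr opprB.
Qed.

Lemma recursive_rat_add p q : recursive_rat e p -> recursive_rat e q ->
  recursive_rat e (fun t => p t + q t).
Proof.
move=> /recursive_rat_fraction [a [b [d [ha hb hd d0 pE]]]].
move=> /recursive_rat_fraction [a' [b' [d' [ha' hb' hd' d0' qE]]]].
apply: (@fraction_recursive_rat _ _ _ (fun t => a t * d' t + a' t * d t)%N
  (fun t => b t * d' t + b' t * d t)%N (fun t => d t * d' t)%N); split.
- exact: recursive_on_add (recursive_on_mul ha hd') (recursive_on_mul ha' hd).
- exact: recursive_on_add (recursive_on_mul hb hd') (recursive_on_mul hb' hd).
- exact: recursive_on_mul.
- by move=> t; rewrite muln_gt0 d0 d0'.
- move=> t; rewrite pE qE !natrD !natrM.
  have d1 : ((d t)%:R : rat) != 0 by rewrite pnatr_eq0 -lt0n.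
  have d2 : ((d' t)%:R : rat) != 0 by rewrite pnatr_eq0 -lt0n.
  by field; rewrite d1 d2.
Qed.

Lemma recursive_rat_mul p q : recursive_rat e p -> recursive_rat e q ->
  recursive_rat e (fun t => p t * q t).
Proof.
move=> /recursive_rat_fraction [a [b [d [ha hb hd d0 pE]]]].
move=> /recursive_rat_fraction [a' [b' [d' [ha' hb' hd' d0' qE]]]].
apply: (@fraction_recursive_rat _ _ _ (fun t => a t * a' t + b t * b' t)%N
  (fun t => a t * b' t + b t * a' t)%N (fun t => d t * d' t)%N); split.
- exact: recursive_on_add (recursive_on_mul ha ha') (recursive_on_mul hb hb').
- exact: recursive_on_add (recursive_on_mul ha hb') (recursive_on_mul hb ha').
- exact: recursive_on_mul.
- by move=> t; rewrite muln_gt0 d0 d0'.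
- move=> t; rewrite pE qE !natrD !natrM.
  have d1 : ((d t)%:R : rat) != 0 by rewrite pnatr_eq0 -lt0n.
  have d2 : ((d' t)%:R : rat) != 0 by rewrite pnatr_eq0 -lt0n.
  by field; rewrite d1 d2.
Qed.

Lemma recursive_rat_max p q : recursive_rat e p -> recursive_rat e q ->
  recursive_rat e (fun t => Num.max (p t) (q t)).
Proof.
move=> /recursive_rat_fraction [a [b [d [ha hb hd d0 pE]]]].
move=> /recursive_rat_fraction [a' [b' [d' [ha' hb' hd' d0' qE]]]].
(* Both fractions are written over the denominator [d * d'] with the same subtrahend
   [b * d' + b' * d], so it suffices to compare the remaining natural numbers. *)
apply: (@fraction_recursive_rat _ _ _
  (fun t => maxn (a t * d' t + b' t * d t) (a' t * d t + b t * d' t))%N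
  (fun t => b t * d' t + b' t * d t)%N (fun t => d t * d' t)%N); split.
- by apply: recursive_on_max; apply: recursive_on_add; apply: recursive_on_mul.
- by apply: recursive_on_add; apply: recursive_on_mul.
- exact: recursive_on_mul.
- by move=> t; rewrite muln_gt0 d0 d0'.
- move=> t; rewrite pE qE natr_max addr_maxl maxr_pMl; last first.
    by rewrite invr_ge0 ler0n.
  have d1 : ((d t)%:R : rat) != 0 by rewrite pnatr_eq0 -lt0n.
  have d2 : ((d' t)%:R : rat) != 0 by rewrite pnatr_eq0 -lt0n.
  by congr Num.max; rewrite !natrD !natrM; field; rewrite d1 d2.
Qed.

Lemma recursive_rat_norm q : recursive_rat e q -> recursive_rat e (fun t => `|q t|).
Proof.
move=> hq; apply: recursive_rat_ext (recursive_rat_max hq (recursive_rat_opp hq)) _.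
by move=> t /=; rewrite maxrN.
Qed.

(** The index list is fixed, so the program is assembled by induction on the list, without a
    recursion inside the model. *)
Lemma recursive_rat_sum (I : Type) (s : seq I) (F : I -> T -> rat) :
  (forall i, recursive_rat e (F i)) ->
  recursive_rat e (fun t => \sum_(i <- s) F i t).
Proof.
move=> hF; elim: s => [|i s IH].
  by apply: recursive_rat_ext (recursive_rat_cst 0) _ => t; rewrite big_nil.
by apply: recursive_rat_ext (recursive_rat_add (hF i) IH) _ => t; rewrite big_cons.
Qed.

End RecursiveRat.

(** * Encoded lists and matrices *)

Lemma recursive_on_nth {T : Type} (e : T -> nat) (l : T -> seq nat) (k : nat) :
  recursive_on e (fun t => enc_list (l t)) -> (forall t, k < size (l t))%N ->
  recursive_on e (fun t => nth 0%N (l t) k).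
Proof.
elim: k l => [|k IH] l hl hk.
  (* A nonempty list is coded by the successor of a pair (head, tail): the predecessor followed by a
     projection extracts either part. *)
  apply: (@recursive_on_fst _ _ _ (fun t => enc_list (behead (l t)))).
  by apply: recursive_on_ext (recursive_on_pred hl) _ => t; case: (l t) (hk t).
apply: recursive_on_ext (IH (fun t => behead (l t)) _ _) _.
- apply: (@recursive_on_snd _ _ (fun t => nth 0%N (l t) 0)).
  by apply: recursive_on_ext (recursive_on_pred hl) _ => t; case: (l t) (hk t).
- by move=> t; case: (l t) (hk t).
- by move=> t /=; rewrite nth_behead.
Qed.

Lemma recursive_on_list {T : Type} (e : T -> nat) (I : Type) (s : seq I)
    (F : I -> T -> nat) :
  (forall i, recursive_on e (F i)) ->
  recursive_on e (fun t => enc_list [seq F i t | i <- s]).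
Proof.
move=> hF; elim: s => [|i s IH] /=; first exact: recursive_on_cst.
by apply: recursive_on_succ; apply: recursive_on_pair.
Qed.

(** Turns the double enumeration into a map over one fixed list of index pairs, the form that
    [recursive_on_nth] and [recursive_on_list] handle. *)
Lemma enc_mxE (N : nat) (A : 'M[rat[i]]_N) :
  enc_mx A = enc_list [seq enc_gauss (A u.1 u.2) |
    u <- [seq (i, j) | i <- enum 'I_N, j <- enum 'I_N]].
Proof. by rewrite map_allpairs. Qed.

Lemma recursive_on_entry {T : Type} (e : T -> nat) (N : nat)
    (A : T -> 'M[rat[i]]_N) (i j : 'I_N) :
  recursive_on e (fun t => enc_mx (A t)) ->
  recursive_on e (fun t => enc_gauss (A t i j)).
Proof.
move=> hA; pose s := [seq (i, j) | i <- enum 'I_N, j <- enum 'I_N].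
have ins : (i, j) \in s by apply: allpairs_f; rewrite mem_enum.
apply: recursive_on_ext (@recursive_on_nth _ e
  (fun t => [seq enc_gauss (A t u.1 u.2) | u <- s]) (index (i, j) s) _ _) _.
- by apply: recursive_on_ext hA _ => t; rewrite enc_mxE.
- by move=> t; rewrite size_map index_mem.
- by move=> t /=; rewrite (nth_map (i, j)) ?index_mem // nth_index.
Qed.

Lemma recursive_on_scalar_mx {T : Type} (e : T -> nat) (N : nat) (q : T -> rat) :
  recursive_rat e q ->
  recursive_on e (fun t => enc_mx ((Complex (q t) 0)%:M : 'M[rat[i]]_N)).
Proof.
move=> hq.
apply: recursive_on_ext (recursive_on_list (e := e)
  [seq (i, j) | i <- enum 'I_N, j <- enum 'I_N]
  (F := fun u t => enc_gauss (Complex (if u.1 == u.2 then q t else 0) 0)) _) _.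
  move=> [i j] /=; apply: recursive_on_pair; last exact: (recursive_on_cst e (enc_rat 0)).
  by case: (i == j) => /=; [exact: hq | exact: recursive_on_cst].
move=> t /=; rewrite enc_mxE; congr enc_list; apply: eq_map => -[i j] /=.
by rewrite mxE; case: (i == j).
Qed.

(** * Quadratic forms and limits *)

Definition code_input (u : nat * str) : nat := cpair u.1 (enc_str u.2).

Lemma total_recursive2P (F : nat -> str -> nat) :
  total_recursive2 F <-> recursive_on code_input (fun u => F u.1 u.2).
Proof.
split=> -[p hp]; exists p; first by move=> -[n s]; exact: hp.
by move=> n s; exact: (hp (n, s)).
Qed.

Definition running_max (u : nat -> rat) (n : nat) : rat :=
  nat_rect (fun=> rat) (u 0%N) (fun k y => Num.max y (u k.+1)) n.

Lemma recursive_rat_running_max (u : nat -> str -> rat) :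
  recursive_rat code_input (fun w => u w.1 w.2) ->
  recursive_rat code_input (fun w => running_max (u^~ w.2) w.1).
Proof.
move=> hu.
have hr : recursive_on (code_fst enc_str)
    (fun w => enc_rat (running_max (u^~ w.1) w.2)).
  apply: (recursive_on_prim (c := enc_rat) (f := fun s => u 0%N s)
    (g := fun s k y => Num.max y (u k.+1 s))).
    apply: (recursive_on_reindex (h := fun s => (0%N, s)) hu).
    exact: recursive_on_pair (recursive_on_cst _ 0) (recursive_on_code _).
  apply: recursive_rat_max; first exact: recursive_rec_acc.
  apply: (recursive_on_reindex (h := fun w : str * nat * rat =>
    (w.1.2.+1, w.1.1)) hu).
  exact: recursive_on_pair (recursive_on_succ (recursive_rec_idx _ _))
    (recursive_rec_ctx _ _).
(* [PRec] counts on the second component, whereas [code_input] carries the stage first; the two are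
   swapped. *)
apply: (recursive_on_reindex (h := fun w : nat * str => (w.2, w.1)) hr).
have hc := recursive_on_code code_input.
exact: recursive_on_pair (recursive_on_snd hc) (recursive_on_fst hc).
Qed.

Lemma running_max_nondecreasing (u : nat -> rat) (n : nat) :
  running_max u n <= running_max u n.+1.
Proof. by rewrite /= le_max lexx. Qed.

Lemma le_running_max (u : nat -> rat) (n : nat) : u n <= running_max u n.
Proof. by case: n => [|n] //=; rewrite le_max lexx orbT. Qed.

Lemma running_max_le (u : nat -> rat) (b : Defs.Real) (n : nat) :
  (forall k, ratr (u k) <= b) -> ratr (running_max u n) <= b.
Proof.
move=> hb; elim: n => [|n IH] /=; first exact: hb.
by rewrite maxEle; case: ifP => _; [exact: hb | exact: IH].
Qed.

(* The real part of [conj(a1 + i a2) (f1 + i f2) (b1 + i b2)]. *)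
Definition re_form {R : pzRingType} (a1 a2 f1 f2 b1 b2 : R) : R :=
  f1 * (a1 * b1 + a2 * b2) - f2 * (a1 * b2 - a2 * b1).

Lemma ratr_re_form (a1 a2 f1 f2 b1 b2 : rat) :
  ratr (re_form a1 a2 f1 f2 b1 b2) =
  re_form (ratr a1) (ratr a2) (ratr f1) (ratr f2) (ratr b1) (ratr b2) :> Defs.Real.
Proof. by rewrite /re_form !(rmorphB, rmorphD, rmorphM) /=. Qed.

(** Since [d <= 1], the approximation [b'] has modulus at most 2; exchanging one factor at a time
    costs [1 * d + 2 * d]. *)
Lemma mul_dist_le (R : realFieldType) (d a a' b b' : R) :
  d <= 1 -> `|a| <= 1 -> `|b| <= 1 -> `|a - a'| <= d -> `|b - b'| <= d ->
  `|a * b - a' * b'| <= 3 * d.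
Proof.
move=> d1 ha hb haa hbb.
have hb' : `|b'| <= 2.
  rewrite -[b'](subKr b); apply: le_trans (ler_normB _ _) _; lra.
have -> : a * b - a' * b' = a * (b - b') + b' * (a - a') by ring.
apply: le_trans (ler_normD _ _) _; rewrite !normrM.
have h1 : `|a| * `|b - b'| <= 1 * d by apply: ler_pM.
have h2 : `|b'| * `|a - a'| <= 2 * d by apply: ler_pM.
lra.
Qed.

(** Each of [f1] and [f2] multiplies a combination of two products, and every product moves by at
    most [3 * d]; hence the constant 6. *)
Lemma re_form_dist_le (R : realFieldType) (d a1 a2 f1 f2 b1 b2 a1' a2' b1' b2' : R) :
  d <= 1 -> `|a1| <= 1 -> `|a2| <= 1 -> `|b1| <= 1 -> `|b2| <= 1 ->
  `|a1 - a1'| <= d -> `|a2 - a2'| <= d -> `|b1 - b1'| <= d -> `|b2 - b2'| <= d ->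
  re_form a1' a2' f1 f2 b1' b2' - 6 * d * (`|f1| + `|f2|)
    <= re_form a1 a2 f1 f2 b1 b2.
Proof.
move=> d1 ha1 ha2 hb1 hb2 da1 da2 db1 db2.
have h11 := mul_dist_le d1 ha1 hb1 da1 db1.
have h22 := mul_dist_le d1 ha2 hb2 da2 db2.
have h12 := mul_dist_le d1 ha1 hb2 da1 db2.
have h21 := mul_dist_le d1 ha2 hb1 da2 db1.
set u := (a1' * b1' + a2' * b2') - (a1 * b1 + a2 * b2).
set v := (a1' * b2' - a2' * b1') - (a1 * b2 - a2 * b1).
have hu : `|u| <= 6 * d.
  by move: h11 h22; rewrite /u !ler_norml => /andP[? ?] /andP[? ?]; lra.
have hv : `|v| <= 6 * d.
  by move: h12 h21; rewrite /v !ler_norml => /andP[? ?] /andP[? ?]; lra.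
have h1 : f1 * u <= `|f1| * (6 * d).
  by apply: le_trans (ler_norm _) _; rewrite normrM ler_wpM2l.
have h2 : - (f2 * v) <= `|f2| * (6 * d).
  by apply: le_trans (ler_norm _) _; rewrite normrN normrM ler_wpM2l.
have -> : re_form a1' a2' f1 f2 b1' b2' =
    re_form a1 a2 f1 f2 b1 b2 + (f1 * u - f2 * v).
  by rewrite /re_form /u /v; ring.
lra.
Qed.

Local Open Scope sesquilinear_scope.

(** * Quadratic forms and the Loewner order *)

Definition qform (N : nat) (A : 'M[Cplx]_N) (v : 'cV[Cplx]_N) : Cplx :=
  (v ^t* *m A *m v) 0 0.

Lemma qformB (N : nat) (A B : 'M[Cplx]_N) (v : 'cV[Cplx]_N) :
  qform (A - B) v = qform A v - qform B v.
Proof. by rewrite /qform mulmxBr mulmxBl !mxE. Qed.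

Lemma qform_sum (N : nat) (I : Type) (l : seq I) (A : I -> 'M[Cplx]_N)
    (v : 'cV[Cplx]_N) :
  qform (\sum_(i <- l) A i) v = \sum_(i <- l) qform (A i) v.
Proof. by rewrite /qform mulmx_sumr mulmx_suml summxE. Qed.

Lemma qform_scalar (N : nat) (c : Cplx) (v : 'cV[Cplx]_N) :
  qform c%:M v = c * \sum_(i < N) `|v i 0| ^+ 2.
Proof.
rewrite /qform mul_mx_scalar -scalemxAl !mxE; congr (_ * _).
by apply: eq_bigr => i _; rewrite !mxE normCK mulrC.
Qed.

Lemma Re_sum (I : Type) (l : seq I) (F : I -> Cplx) :
  complex.Re (\sum_(i <- l) F i) = \sum_(i <- l) complex.Re (F i).
Proof.
by apply: (big_morph (@complex.Re Defs.Real)) => // -[a b] [c d].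
Qed.

(** Real coordinates allow error bounds and limits to be treated separately for each pair of
    indices. *)
Lemma Re_qform (N : nat) (A : 'M[Cplx]_N) (v : 'cV[Cplx]_N) :
  complex.Re (qform A v) = \sum_(u : 'I_N * 'I_N)
    re_form (complex.Re (v u.1 0)) (complex.Im (v u.1 0))
            (complex.Re (A u.1 u.2)) (complex.Im (A u.1 u.2))
            (complex.Re (v u.2 0)) (complex.Im (v u.2 0)).
Proof.
rewrite /qform mxE -(pair_bigA _ (fun i j => re_form
  (complex.Re (v i 0)) (complex.Im (v i 0))
  (complex.Re (A i j)) (complex.Im (A i j))
  (complex.Re (v j 0)) (complex.Im (v j 0)))) /= exchange_big Re_sum /=.
apply: eq_bigr => j _; rewrite mxE mulr_suml Re_sum; apply: eq_bigr => i _.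
rewrite !mxE; case: (v i 0) => a1 a2; case: (v j 0) => b1 b2.
case: (A i j) => f1 f2; rewrite /re_form /=; ring.
Qed.

Lemma loewner_le_Re_qform (N : nat) (A B : 'M[Cplx]_N) (v : 'cV[Cplx]_N) :
  loewner_le A B -> complex.Re (qform A v) <= complex.Re (qform B v).
Proof.
move=> [_ /(_ v)]; rewrite -/(qform _ _) qformB subr_ge0 lecE.
by case/andP.
Qed.

Lemma hermsym_real_scalar (N : nat) (c : Defs.Real) :
  ((Complex c 0)%:M : 'M[Cplx]_N) \is hermsymmx.
Proof.
apply/is_hermitianmxP; rewrite expr0 scale1r tr_scalar_mx map_scalar_mx.
by congr (_%:M); rewrite [RHS](conjc_real c).
Qed.

Lemma loewner_le_real_scalar (N : nat) (a b : Defs.Real) : a <= b ->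
  loewner_le ((Complex a 0)%:M : 'M[Cplx]_N) (Complex b 0)%:M.
Proof.
move=> ab; rewrite /loewner_le -raddfB.
have -> : Complex b 0 - Complex a 0 = Complex (b - a) 0 :> Cplx.
  by apply/eqP; rewrite eq_complex /= subr0 !eqxx.
split; first exact: hermsym_real_scalar.
move=> v; rewrite -/(qform _ _) qform_scalar mulr_ge0 //.
  by rewrite (ler0c (b - a)) subr_ge0.
by apply: sumr_ge0 => i _; rewrite exprn_ge0.
Qed.

Lemma sum_real_scalar (N : nat) (I : Type) (l : seq I) (r : I -> Defs.Real) :
  \sum_(i <- l) (Complex (r i) 0)%:M =
  (Complex (\sum_(i <- l) r i) 0)%:M :> 'M[Cplx]_N.
Proof.
elim: l => [|i l IH]; first by rewrite !big_nil raddf0.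
by rewrite !big_cons IH -raddfD; congr (_%:M); apply/eqP;
  rewrite eq_complex /= addr0 !eqxx.
Qed.

(** * Limits of real sequences *)

Section Limits.
(* The topology found on [Defs.Real] is the one declared on Stdlib's [R]; the
   lemmas are stated for all [realType]s and transferred by conversion. *)
Import numFieldNormedType.Exports.
Local Open Scope classical_set_scope.
Variable R : realType.

Lemma cvg_nondecreasing_ge (u : nat -> R) (l : R) (n : nat) :
  (forall k, u k <= u k.+1) -> u @ \oo --> l -> u n <= l.
Proof.
move=> hu hl; rewrite -(cvg_lim _ hl) //.
apply: nondecreasing_cvgn_le; last by apply/cvg_ex; exists l.
exact/nondecreasing_seqP.
Qed.

Lemma cvg_exp2V : (fun n => ((2 : R) ^+ n)^-1) @ \oo --> (0 : R).
Proof.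
under eq_fun do rewrite -exprVn.
by apply: cvg_expr; rewrite gtr0_norm ?invf_lt1 ?invr_gt0 ?ltr0n ?ltr1n.
Qed.

Lemma cvg_dist_exp2V (u : nat -> R) (l : R) :
  (forall n, `|l - u n| <= ((2 : R) ^+ n)^-1) -> u @ \oo --> l.
Proof.
move=> hu; apply: (@squeeze_cvgr _ _ _ _ (fun n => l - ((2 : R) ^+ n)^-1)
  (fun n => l + ((2 : R) ^+ n)^-1)).
- by near=> n; have := hu n; rewrite ler_distlC.
- by rewrite -[X in _ --> X]subr0; apply: cvgB cvg_exp2V; exact: cvg_cst.
- by rewrite -[X in _ --> X]addr0; apply: cvgD cvg_exp2V; exact: cvg_cst.
Unshelve. all: by end_near. Qed.

Lemma cvg_between (u v : nat -> R) (l : R) :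
  (forall n, u n <= v n) -> (forall n, v n <= l) -> u @ \oo --> l -> v @ \oo --> l.
Proof.
move=> uv vl ul; apply: (@squeeze_cvgr _ _ _ _ u (fun=> l)) => //.
- by near=> n; rewrite uv vl.
- exact: cvg_cst.
Unshelve. all: by end_near. Qed.

Lemma cvg_re_form (a1 a2 f1 f2 b1 b2 : nat -> R) (x1 x2 y1 y2 z1 z2 : R) :
  a1 @ \oo --> x1 -> a2 @ \oo --> x2 -> f1 @ \oo --> y1 -> f2 @ \oo --> y2 ->
  b1 @ \oo --> z1 -> b2 @ \oo --> z2 ->
  (fun n => re_form (a1 n) (a2 n) (f1 n) (f2 n) (b1 n) (b2 n)) @ \oo -->
  re_form x1 x2 y1 y2 z1 z2.
Proof.
move=> ha1 ha2 hf1 hf2 hb1 hb2.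
by apply: cvgB; apply: cvgM => //; [apply: cvgD|apply: cvgB]; apply: cvgM.
Qed.

(** Here [t] will be the terms of the approximate form and [g] the weights of the subtracted error
    bound. That bound is a null sequence times a convergent one, so it does not affect the limit. *)
Lemma cvg_perturbed_sum (I : finType) (t g : I -> nat -> R) (x y : I -> R) :
  (forall i, t i @ \oo --> x i) -> (forall i, g i @ \oo --> y i) ->
  (fun n => \sum_i t i n - 6 * ((2 : R) ^+ n)^-1 * \sum_i g i n) @ \oo -->
  \sum_i x i.
Proof.
move=> ht hg.
have sum_cvg (h : I -> nat -> R) (z : I -> R) : (forall i, h i @ \oo --> z i) ->
    (fun n => \sum_i h i n) @ \oo --> \sum_i z i.
  by move=> hz; apply: cvg_big => [|i _]; [exact: add_continuous | exact: hz].
have small : (fun n => 6 * ((2 : R) ^+ n)^-1) @ \oo --> (0 : R).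
  by rewrite -(mulr0 6); apply: cvgM cvg_exp2V; exact: cvg_cst.
have -> : \sum_i x i = \sum_i x i - 0 * \sum_i y i by rewrite mul0r subr0.
apply: cvgB; first exact: sum_cvg.
by apply: (cvgM small); exact: sum_cvg.
Qed.

Lemma cvg_norm_add (f1 f2 : nat -> R) (y1 y2 : R) :
  f1 @ \oo --> y1 -> f2 @ \oo --> y2 ->
  (fun n => `|f1 n| + `|f2 n|) @ \oo --> `|y1| + `|y2|.
Proof. by move=> h1 h2; apply: cvgD; apply: cvg_norm. Qed.

End Limits.

(** * Semi-measures as scalar semi-POVMs *)

Lemma real_scalar_lower_computable (N : nat) (r : str -> Defs.Real) :
  lower_computable_semi_measure r ->
  lower_computable_semi_POVM (fun s => (Complex (r s) 0)%:M : 'M[Cplx]_N).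
Proof.
move=> [[r0 r1] [f [/total_recursive2P frec [flim fmon]]]].
have gmxE n s : gmx ((Complex (f n s) 0)%:M : 'M[rat[i]]_N) =
    (Complex (ratr (f n s)) 0)%:M.
  apply/matrixP => i j; rewrite !mxE; case: (i == j) => /=.
    by rewrite /gauss_to_C /= rmorph0.
  by rewrite /gauss_to_C /= rmorph0.
split.
  split; first by move=> s; exact: hermsym_real_scalar.
  split=> [s|l ul]; first by have := loewner_le_real_scalar N (r0 s); rewrite raddf0.
  by rewrite sum_real_scalar; exact/loewner_le_real_scalar/r1.
exists (fun n s => (Complex (f n s) 0)%:M); split.
  by apply/total_recursive2P; exact: recursive_on_scalar_mx frec.
split; first by move=> n s; rewrite gmxE; exact: hermsym_real_scalar.
split=> [s i j|n s].
  (* Off-diagonal entries and imaginary parts are constantly zero; only the real diagonal part needs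
     the convergence of [f]. *)
  split; under eq_fun do rewrite gmxE mxE; rewrite mxE;
    case: (i == j) => /=; try exact: cvg_cst.
  exact: flim.
rewrite gmxE; apply: loewner_le_real_scalar.
(* Semi-measures are approximated monotonically, semi-POVMs merely from below: a nondecreasing
   sequence stays below its limit. *)
apply: (@cvg_nondecreasing_ge Defs.Real (fun k => ratr (f k s))) => // k.
by rewrite ler_rat.
Qed.

(** * Lower computability of the quadratic form *)

(** Provides the bounds by 1 on the exact coordinates that [re_form_dist_le] requires. *)
Lemma norm_component_le1 (N : nat) (x : 'cV[Cplx]_N) (i : 'I_N) :
  \sum_(i < N) `|x i 0| ^+ 2 = 1 ->
  `|complex.Re (x i 0)| <= 1 /\ `|complex.Im (x i 0)| <= 1.
Proof.
move=> hx.
have le1 : complex.Re (x i 0) ^+ 2 + complex.Im (x i 0) ^+ 2 <= 1.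
  suff : `|x i 0| ^+ 2 <= 1 by rewrite -add_Re2_Im2 lecE => /andP[].
  rewrite -hx (bigD1 i) //= lerDl.
  by apply: sumr_ge0 => j _; rewrite exprn_ge0.
by split; rewrite -(expr_le1 (ltn0Sn 1)) // real_normK ?num_real //;
  apply: le_trans le1; rewrite ?lerDl ?lerDr sqr_ge0.
Qed.

Section LowerComputability.
Variables (N : nat) (x : 'cV[Cplx]_N) (g1 g2 : 'I_N -> nat -> rat).
Hypothesis x1 : \sum_(i < N) `|x i 0| ^+ 2 = 1.
Hypothesis g1_rec : forall i, total_recursive (fun n => enc_rat (g1 i n)).
Hypothesis g2_rec : forall i, total_recursive (fun n => enc_rat (g2 i n)).
Hypothesis g1_approx : forall i n,
  `|complex.Re (x i 0) - ratr (g1 i n)| <= ((2 : Defs.Real) ^+ n)^-1.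
Hypothesis g2_approx : forall i n,
  `|complex.Im (x i 0) - ratr (g2 i n)| <= ((2 : Defs.Real) ^+ n)^-1.

Definition approx_qform (F : 'M[rat[i]]_N) (n : nat) : rat :=
  \sum_(u : 'I_N * 'I_N) re_form (g1 u.1 n) (g2 u.1 n)
    (complex.Re (F u.1 u.2)) (complex.Im (F u.1 u.2)) (g1 u.2 n) (g2 u.2 n).

(* The subtracted term dominates the error made by replacing [x] with its
   [n]-th rational approximation, whence [lower_qform_le]. *)
Definition lower_qform (F : 'M[rat[i]]_N) (n : nat) : rat :=
  approx_qform F n - 6 * (2 ^+ n)^-1 *
    \sum_(u : 'I_N * 'I_N) (`|complex.Re (F u.1 u.2)| + `|complex.Im (F u.1 u.2)|).

Lemma ratr_lower_qform (F : 'M[rat[i]]_N) (n : nat) :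
  ratr (lower_qform F n) = \sum_(u : 'I_N * 'I_N)
      re_form (ratr (g1 u.1 n)) (ratr (g2 u.1 n))
        (complex.Re (gmx F u.1 u.2)) (complex.Im (gmx F u.1 u.2))
        (ratr (g1 u.2 n)) (ratr (g2 u.2 n))
    - 6 * (2 ^+ n)^-1 * \sum_(u : 'I_N * 'I_N)
      (`|complex.Re (gmx F u.1 u.2)| + `|complex.Im (gmx F u.1 u.2)|) :> Defs.Real.
Proof.
rewrite /lower_qform /approx_qform rmorphB !rmorphM /= fmorphV rmorphXn /= !ratr_nat.
rewrite !rmorph_sum /=; congr (_ - _ * _); apply: eq_bigr => u _; rewrite !mxE.
  by rewrite ratr_re_form.
by rewrite rmorphD /= !ratr_norm.
Qed.

Lemma lower_qform_le (F : 'M[rat[i]]_N) (n : nat) :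
  ratr (lower_qform F n) <= complex.Re (qform (gmx F) x).
Proof.
rewrite ratr_lower_qform Re_qform mulr_sumr -sumrB; apply: ler_sum => u _.
have [r1 i1] := norm_component_le1 u.1 x1.
have [r2 i2] := norm_component_le1 u.2 x1.
apply: re_form_dist_le => //.
by rewrite invf_le1 ?exprn_gt0 ?ltr0n // exprn_ege1 ?ler1n.
Qed.

Lemma lower_qform_cvg (F : nat -> 'M[rat[i]]_N) (A : 'M[Cplx]_N) :
  mx_cvg (fun n => gmx (F n)) A ->
  ((fun n => ratr (lower_qform (F n) n) : Defs.Real) @ \oo -->
    complex.Re (qform A x))%classic.
Proof.
move=> hF; under eq_fun do rewrite ratr_lower_qform; rewrite Re_qform.
apply: (@cvg_perturbed_sum Defs.Real _
  (fun u n => re_form (ratr (g1 u.1 n)) (ratr (g2 u.1 n))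
        (complex.Re (gmx (F n) u.1 u.2)) (complex.Im (gmx (F n) u.1 u.2))
        (ratr (g1 u.2 n)) (ratr (g2 u.2 n)))
  (fun u n => `|complex.Re (gmx (F n) u.1 u.2)| + `|complex.Im (gmx (F n) u.1 u.2)|)
  _ (fun u => `|complex.Re (A u.1 u.2)| + `|complex.Im (A u.1 u.2)|)) => u;
  have [hr hi] := hF u.1 u.2.
  by apply: (@cvg_re_form Defs.Real) => //; exact: (@cvg_dist_exp2V Defs.Real).
exact: (@cvg_norm_add Defs.Real).
Qed.

Lemma lower_qform_recursive (f : nat -> str -> 'M[rat[i]]_N) :
  total_recursive2 (fun n s => enc_mx (f n s)) ->
  recursive_rat code_input (fun w => lower_qform (f w.1 w.2) w.1).
Proof.
move=> /total_recursive2P frec.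
have nrec : recursive_on code_input (fun w => w.1).
  by apply: recursive_on_fst; exact: recursive_on_code.
have grec1 i : recursive_rat code_input (fun w => g1 i w.1).
  exact: (recursive_on_comp (g1_rec i) nrec).
have grec2 i : recursive_rat code_input (fun w => g2 i w.1).
  exact: (recursive_on_comp (g2_rec i) nrec).
have frec1 i j : recursive_rat code_input (fun w => complex.Re (f w.1 w.2 i j)).
  exact: recursive_on_fst (recursive_on_entry i j frec).
have frec2 i j : recursive_rat code_input (fun w => complex.Im (f w.1 w.2 i j)).
  exact: recursive_on_snd (recursive_on_entry i j frec).
apply: recursive_rat_add.
  apply: recursive_rat_sum => u; apply: recursive_rat_add.
    apply: recursive_rat_mul => //.
    by apply: recursive_rat_add; apply: recursive_rat_mul.
  apply: recursive_rat_opp; apply: recursive_rat_mul => //.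
  apply: recursive_rat_add; first exact: recursive_rat_mul.
  by apply: recursive_rat_opp; apply: recursive_rat_mul.
apply: recursive_rat_opp; apply: recursive_rat_mul.
  apply: recursive_rat_mul; first exact: recursive_rat_cst.
  (* The factor [2^-n] is presented as the fraction [(1 - 0) / 2^n]. *)
  apply: (@fraction_recursive_rat _ _ _ (fun=> 1%N) (fun=> 0%N)
    (fun w => 2 ^ w.1)%N); split.
  - exact: recursive_on_cst.
  - exact: recursive_on_cst.
  - exact: recursive_on_exp.
  - by move=> w; rewrite expn_gt0.
  - by move=> w; rewrite subr0 mul1r natrX.
apply: recursive_rat_sum => u.
by apply: recursive_rat_add; apply: recursive_rat_norm.
Qed.

End LowerComputability.

(** Both inequalities come from evaluating the semi-POVM conditions at [x], where the identity takes
    the value 1. *)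
Lemma quad_form_semi_measure (N : nat) (M : str -> 'M[Cplx]_N) (x : 'cV[Cplx]_N) :
  semi_POVM M -> \sum_(i < N) `|x i 0| ^+ 2 = 1 -> semi_measure (quad_form M x).
Proof.
move=> [_ [M0 M1]] x1; split=> [s|l ul].
  have := loewner_le_Re_qform x (M0 s).
  by rewrite -(raddf0 (@scalar_mx _ N)) qform_scalar mul0r.
have := loewner_le_Re_qform x (M1 l ul).
by rewrite qform_scalar x1 mulr1 qform_sum Re_sum.
Qed.

Lemma quad_form_lower_computable (N : nat) (M : str -> 'M[Cplx]_N)
    (x : 'cV[Cplx]_N) :
  lower_computable_semi_POVM M -> computable_vec x ->
  \sum_(i < N) `|x i 0| ^+ 2 = 1 ->
  lower_computable_semi_measure (quad_form M x).
Proof.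
move=> [MP [f [frec [_ [flim fle]]]]] xcomp x1.
split; first exact: quad_form_semi_measure.
(* Choice gathers the approximating sequences of the coordinates, each with its own program, into
   one family indexed by [i]. *)
have [g1 hg1] := choice (fun i => (xcomp i).1).
have [g2 hg2] := choice (fun i => (xcomp i).2).
have le_quad n s : ratr (lower_qform g1 g2 (f n s) n) <= quad_form M x s.
  apply: le_trans (loewner_le_Re_qform x (fle n s)).
  by apply: lower_qform_le => // i; [have [_] := hg1 i | have [_] := hg2 i].
exists (fun n s => running_max (fun k => lower_qform g1 g2 (f k s) k) n); split.
  apply/total_recursive2P.
  apply: (@recursive_rat_running_max (fun k s => lower_qform g1 g2 (f k s) k)).
  by apply: lower_qform_recursive => // i; [have [] := hg1 i | have [] := hg2 i].
split=> [s|n s]; last exact: running_max_nondecreasing.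
(* The running maximum is squeezed between the current lower bound, which converges to the quadratic
   form, and the quadratic form itself. *)
apply: (@cvg_between Defs.Real
  (fun n => ratr (lower_qform g1 g2 (f n s) n))).
- by move=> n; rewrite ler_rat; exact: le_running_max.
- by move=> n; exact: running_max_le.
- apply: (lower_qform_cvg (x := x)) => //.
  + by move=> i; have [_] := hg1 i.
  + by move=> i; have [_] := hg2 i.
Qed.

(** * Universality of the quadratic form *)

Unset Implicit Arguments.
Set Strict Implicit.

Theorem mainTheorem11 (N : nat) (M : str -> 'M[Cplx]_N) (x : 'cV[Cplx]_N) :
  (0 < N)%N ->
  universal_semi_POVM M ->
  computable_vec x ->
  \sum_(i < N) `|x i 0| ^+ 2 = 1 ->
  universal_probability (quad_form M x).
Proof.
move=> _ [Mlc Muniv] xcomp x1; split; first exact: quad_form_lower_computable.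
move=> r /(real_scalar_lower_computable N) /Muniv [c [c0 hc]].
exists c; split=> // s; have := loewner_le_Re_qform x (hc s).
by rewrite scale_scalar_mx qform_scalar x1 mulr1 /= mul0r subr0.
Qed.
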